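(* Let $(\mathbb{S},\Sigma)$ be a measurable space, let the sequence $\{\mu^{(n)}\}_{n=1,2,\ldots}\subset\mathcal{M}(\mathbb{S})$ converge in total variation to a measure $\mu$ on $\mathbb{S}$, let $f^{(n)}\in L^1(\mathbb{S};\mu^{(n)})$, $n=1,2,\ldots$, be nonnegative functions, and let $f\in L^1(\mathbb{S};\mu)$. Then the inequality $$\liminf_{n\to\infty}\ \inf_{S\in\Sigma}\left(\int_S f^{(n)}(s)\,\mu^{(n)}(ds)-\int_S f(s)\,\mu(ds)\right)\ge 0$$ holds if and only if for each $\varepsilon>0$ $$\mu(\{s\in\mathbb{S}: f^{(n)}(s)\le f(s)-\varepsilon\})\to 0\quad\text{as } n\to\infty,$$ and, therefore (as a consequence of this convergence), there exists a subsequence $\{f^{(n_k)}\}_{k=1,2,\ldots}$ of $\{f^{(n)}\}_{n=1,2,\ldots}$ such that $\liminf_{k\to\infty} f^{(n_k)}(s)\ge f(s)$ for $\mu$-a.e. $s\in\mathbb{S}$.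
   Context: $\mathcal{M}(\mathbb{S})$ is the family of finite (nonnegative) measures on $(\mathbb{S},\Sigma)$. Functions $f:\mathbb{S}\to\overline{\mathbb{R}}:=\mathbb{R}\cup\{\pm\infty\}$ are called measurable if $\{s\in\mathbb{S}: f(s)<\alpha\}\in\Sigma$ for each $\alpha\in\mathbb{R}$. For a finite measure $\nu$, $L^1(\mathbb{S};\nu)$ is the set of all measurable functions $g:\mathbb{S}\to\overline{\mathbb{R}}$ with $\int_{\mathbb{S}}|g(s)|\,\nu(ds)<+\infty$ (functions, not equivalence classes). For $\mu\in\mathcal{M}(\mathbb{S})$ and a measure $\nu$ on $\mathbb{S}$, $\mathrm{dist}(\mu,\nu):=\sup\{|\int_{\mathbb{S}} g\,d\mu-\int_{\mathbb{S}} g\,d\nu| : g:\mathbb{S}\to[-1,1]\text{ measurable}\}$; finite measures $\mu^{(n)}$ converge in total variation to a measure $\mu$ if $\lim_{n\to\infty}\mathrm{dist}(\mu^{(n)},\mu)=0$ (then $\mu$ is automatically finite). *)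

(* Defs.v *)
From HB Require Import structures.
From mathcomp Require Import all_boot all_order all_algebra.
From mathcomp Require Import all_classical all_reals all_analysis.
Import Order.TTheory GRing.Theory Num.Theory.
Import numFieldNormedType.Exports.

Set Implicit Arguments.
Unset Strict Implicit.
Unset Printing Implicit Defensive.

Local Open Scope classical_set_scope.
Local Open Scope ring_scope.
Local Open Scope ereal_scope.

(* [nu] may be infinite: taking g = 1 then gives the value +oo. Values of
   `|x - y| with an infinite y are +oo as well, so the total (pos - neg)
   integral of a g that is not nu-integrable does no harm. *)
Definition tv_dist d (T : measurableType d) (R : realType)
    (mu : {finite_measure set T -> \bar R})
    (nu : {measure set T -> \bar R}) : \bar R :=
  ereal_sup [set `| \int[mu]_s (g s)%:E - \int[nu]_s (g s)%:E |
            | g in [set g : T -> R | measurable_fun setT g /\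
                                     forall s, (-1 <= g s <= 1)%R]].

Definition cvg_total_variation d (T : measurableType d) (R : realType)
    (mu_ : nat -> {finite_measure set T -> \bar R})
    (mu : {measure set T -> \bar R}) : Prop :=
  tv_dist (mu_ n) mu @[n --> \oo] --> 0.

(* Main.v *)
Require Import Defs.
From HB Require Import structures.
From mathcomp Require Import all_boot all_order all_algebra.
From mathcomp Require Import all_classical all_reals all_analysis.
From mathcomp Require Import measurable_realfun.
From mathcomp Require Import ring lra.
Import Order.TTheory GRing.Theory Num.Theory.
Import numFieldNormedType.Exports.

Set Implicit Arguments.
Unset Strict Implicit.
Unset Printing Implicit Defensive.

Local Open Scope classical_set_scope.
Local Open Scope ring_scope.
Local Open Scope ereal_scope.

(** Both implications compare the integral of [f_ n] against [mu_ n] with an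
integral against the fixed measure [mu], and the only obstruction is that total
variation controls integrals of bounded functions only. Everything is thus
truncated at a large level [K]: for [0 <= g <= K] the integrals of [g] against
[mu_ n] and [mu] differ by at most [K * tv_dist (mu_ n) mu]
([tv_dist_integral]), and integrability of [f] makes the part of [f] above [K]
small for [mu] ([integrable_upper_level], [integrable_tail]). The level [K] is
fixed first, [n] is taken large afterwards.

Necessity: the infimum over [S] is tested on the set where
[f_ n <= f - eps] and [f <= K]. There [f_ n] is bounded by [K], and its
integral against [mu] lies below that of [f] by at least [eps * mu S]; a lower
bound close to [0] on the difference of integrals therefore forces [mu S] to be
small ([deficit_mass_le]).

Sufficiency: the pointwise inequality
[f <= min (f_ n) K + eps + K * 1_A + max (f - K) 0], with
[A = {f_ n <= f - eps}], can be integrated over any measurable [S]. The four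
error terms are bounded by their integrals over the whole space, hence
uniformly in [S] ([integral_le_deficit]).

Subsequence: choosing [phi] such that the set
[{f_ (phi k) <= f - 2 ^ -(k+1)}] has measure at most [2 ^ -(k+1)], the
Borel-Cantelli lemma puts almost every point in finitely many of these sets. *)

(** * Limits of extended real sequences in epsilon form *)

Lemma ge0_cvge0P (R : realType) (u : nat -> \bar R) :
  (forall n, 0 <= u n) ->
  u n @[n --> \oo] --> 0 <->
  forall e : R, (0 < e)%R -> \forall n \near \oo, u n <= e%:E.
Proof.
move=> u0; split.
  move=> /fine_cvgP[ufin /cvgrPdist_le ule] e e0.
  near=> n.
  have fn : u n \is a fin_num by near: n.
  rewrite -(fineK fn) lee_fin.
  have : (`|0 - (fine \o u) n| <= e)%R by near: n; exact: ule.
  by rewrite sub0r normrN /= ger0_norm// fine_ge0.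
move=> ule; have ufin : \forall n \near \oo, u n \is a fin_num.
  near=> n; rewrite ge0_fin_numE//.
  apply: (@le_lt_trans _ _ 1%:E); last exact: ltry.
  by near: n; apply: ule.
apply/fine_cvgP; split => //; apply/cvgrPdist_le => e e0; near=> n.
rewrite sub0r normrN /= ger0_norm ?fine_ge0//.
rewrite -lee_fin fineK; last by near: n.
by near: n; exact: ule.
Unshelve. all: by end_near. Qed.

Lemma limn_einf_ge (R : realType) (u : nat -> \bar R) (l : \bar R) :
  (forall e : R, (0 < e)%R -> \forall n \near \oo, l - e%:E <= u n) ->
  l <= limn_einf u.
Proof.
move=> lu; apply/lee_subgt0Pr => e e0; rewrite limn_einf_lim.
have [N _ luN] := lu e e0.
apply: lime_ge; first exact: is_cvg_einfs.
near=> n; apply: le_ereal_inf_tmp => _ [k /= nk <-].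
apply: luN => /=; apply: leq_trans nk.
by near: n; exact: nbhs_infty_ge.
Unshelve. all: by end_near. Qed.

Lemma lt_limn_einf (R : realType) (u : nat -> \bar R) (x : \bar R) :
  x < limn_einf u -> \forall n \near \oo, x <= u n.
Proof.
rewrite limn_einf_lim (cvg_lim _ (@cvg_einfs_sup _ u))// => /ereal_sup_gt.
move=> [_ [N _ <-] xN]; near=> n.
apply: (le_trans (ltW xN)); apply: ereal_inf_lbound; exists n => //=.
by near: n; exact: nbhs_infty_ge.
Unshelve. all: by end_near. Qed.

(** * Total variation distance *)

(** After division by [K] the function [g] is one of the test functions in the
definition of [tv_dist], up to its values being extended reals. *)
Lemma tv_dist_integral (d : measure_display) (T : measurableType d)
    (R : realType) (m : {finite_measure set T -> \bar R})
    (mu : {measure set T -> \bar R}) (g : T -> \bar R) (K : R) :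
  (0 < K)%R -> measurable_fun [set: T] g -> (forall s, 0 <= g s <= K%:E) ->
  `| \int[m]_s g s - \int[mu]_s g s | <= K%:E * tv_dist m mu.
Proof.
move=> K0 mg g0K; pose h s := (K^-1 * fine (g s))%R.
have gfin s : g s \is a fin_num.
  have /andP[g0 gK] := g0K s.
  by rewrite ge0_fin_numE// (le_lt_trans gK)// ltry.
have mh : measurable_fun [set: T] h.
  by apply: measurable_funM => //; exact: measurableT_comp.
have h01 s : (0 <= h s <= 1)%R.
  have /andP[g0 gK] := g0K s.
  rewrite /h mulr_ge0 ?invr_ge0 ?(ltW K0) ?fine_ge0//=.
  by rewrite ler_pdivrMl// mulr1 -lee_fin fineK.
have intE (nu : {measure set T -> \bar R}) :
    \int[nu]_s g s = K%:E * \int[nu]_s (h s)%:E.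
  rewrite -ge0_integralZl_EFin ?(ltW K0)//.
  - apply: eq_integral => s _.
    by rewrite -EFinM /h mulrA divff ?gt_eqF// mul1r fineK.
  - by move=> s _; rewrite lee_fin; have /andP[] := h01 s.
  - exact/measurable_EFinP.
have hfin : \int[m]_s (h s)%:E \is a fin_num.
  apply: integrable_fin_num => //.
  apply: (@le_integrable _ _ _ _ _ _ _ (cst 1%:E)) => //.
  - exact/measurable_EFinP.
  - move=> s _ /=; rewrite lee_fin normr1; have /andP[? ?] := h01 s.
    by rewrite ger0_norm.
  - exact: finite_measure_integrable_cst.
rewrite !intE -muleBr//; last by rewrite fin_num_adde_defr.
rewrite abseM gee0_abs; last by rewrite lee_fin ltW.
apply: lee_wpmul2l; first by rewrite lee_fin ltW.
apply: ereal_sup_ubound; exists h => //; split => // s.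
have /andP[h0 ->] := h01 s.
by rewrite (le_trans _ h0)// lerN10.
Qed.

Lemma tv_dist_ge0 (d : measure_display) (T : measurableType d)
    (R : realType) (m : {finite_measure set T -> \bar R})
    (mu : {measure set T -> \bar R}) : 0 <= tv_dist m mu.
Proof.
apply: (@le_trans _ _ (1%:E * tv_dist m mu)); last by rewrite mul1e.
apply: le_trans (@tv_dist_integral _ _ _ m mu (cst 0) 1 ltr01 _ _) => //=.
by move=> s; rewrite lexx lee_fin ler01.
Qed.

(** If [mu] had infinite mass, the test function [1] would put every [mu_ n] at
infinite distance from [mu]. *)
Lemma cvg_total_variation_finite (d : measure_display) (T : measurableType d)
    (R : realType) (mu_ : nat -> {finite_measure set T -> \bar R})
    (mu : {measure set T -> \bar R}) :
  cvg_total_variation mu_ mu -> mu [set: T] < +oo.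
Proof.
move=> /fine_cvgP[[N _ /(_ N (leqnn N)) dfin] _].
rewrite ltey; apply/negP => /eqP muoo.
have := @tv_dist_integral _ _ _ (mu_ N) mu (cst 1) 1 ltr01.
rewrite !integral_cst// !mul1e muoo.
rewrite addeNy /= => /(_ (measurable_cst _)).
have b s : 0 <= (cst 1 : T -> \bar R) s <= 1%:E by rewrite /= lexx lee_fin ler01.
by move=> /(_ b); rewrite leye_eq => /eqP dE; move: dfin; rewrite dE.
Qed.

(** * The two integral estimates *)

Lemma measurable_deficit_set (d : measure_display) (T : measurableType d)
    (R : realType) (f g : T -> \bar R) (eps : R) :
  measurable_fun [set: T] f -> measurable_fun [set: T] g ->
  measurable [set s | g s <= f s - eps%:E].
Proof.
move=> mf mg; rewrite -[X in measurable X]setTI; apply: measurable_lee => //.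
exact: emeasurable_funB.
Qed.

(** The key estimate for necessity. On [S] one has [0 <= g <= K], so exchanging
[m] for [mu] in the integral of [g] costs at most [K * tv_dist m mu]; against
[mu] the pointwise gap [eps] between [g] and [f] integrates to
[eps * mu S]. *)
Lemma deficit_mass_le (d : measure_display) (T : measurableType d)
    (R : realType) (m : {finite_measure set T -> \bar R})
    (mu : {measure set T -> \bar R}) (f g : T -> \bar R) (eps K : R)
    (S : set T) :
  (0 < eps)%R -> (0 < K)%R -> measurable S ->
  m.-integrable [set: T] g -> mu.-integrable [set: T] f -> mu [set: T] < +oo ->
  (forall s, 0 <= g s) ->
  (forall s, S s -> g s <= f s - eps%:E /\ f s <= K%:E) ->
  eps%:E * mu S + (\int[m]_(s in S) g s - \int[mu]_(s in S) f s) <=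
  K%:E * tv_dist m mu.
Proof.
move=> eps0 K0 mS ig jf muT g0 gfK.
have mf := measurable_int _ jf; have mg := measurable_int _ ig.
have gS0K s : 0 <= (g \_ S) s <= K%:E.
  rewrite patchE; case: ifPn => [/set_mem Ss|_]; last first.
    by rewrite lexx lee_fin; exact: ltW.
  have [gf fK] := gfK s Ss.
  rewrite g0 (le_trans gf)// (le_trans _ fK)// leeBlDr//.
  by rewrite leeDl// lee_fin ltW.
have mgS : measurable_fun [set: T] (g \_ S).
  exact: (measurable_restrictT g mS).1 (measurable_funTS mg).
have := tv_dist_integral m mu K0 mgS gS0K.
rewrite -!integral_mkcond => tv.
have int_gf : \int[mu]_(s in S) g s + eps%:E * mu S <= \int[mu]_(s in S) f s.
  rewrite -(integral_cst mu mS eps%:E) -ge0_integralD//.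
  - apply: ge0_le_integral => //.
    + by move=> s _; rewrite adde_ge0// lee_fin ltW.
    + by apply: emeasurable_funD => //; exact: measurable_funTS.
    + exact: measurable_funTS.
    + by move=> s Ss /=; have [gf _] := gfK s Ss; rewrite -leeBrDr.
  - exact: measurable_funTS.
  - by move=> s _; rewrite lee_fin ltW.
have ffin : \int[mu]_(s in S) f s \is a fin_num.
  by apply: integrable_fin_num => //; exact: integrableS jf.
have gmfin : \int[m]_(s in S) g s \is a fin_num.
  by apply: integrable_fin_num => //; exact: integrableS ig.
have muSfin : mu S \is a fin_num.
  rewrite ge0_fin_numE// (le_lt_trans _ muT)// le_measure ?inE//.
have gfin : \int[mu]_(s in S) g s \is a fin_num.
  rewrite ge0_fin_numE; last exact: integral_ge0.
  apply: (@le_lt_trans _ _ (\int[mu]_(s in S) f s)); last by rewrite ltey_eq ffin.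
  by apply: le_trans int_gf; rewrite leeDl// mule_ge0// lee_fin ltW.
apply: le_trans tv; apply: le_trans (lee_abs _).
move: int_gf; rewrite -(fineK gfin) -(fineK gmfin) -(fineK ffin) -(fineK muSfin).
rewrite -!EFinM -!EFinN -!EFinD !lee_fin; lra.
Qed.

(** The key estimate for sufficiency. The error terms do not involve [S], which
gives the uniformity that the infimum over all measurable sets requires. *)
Lemma integral_le_deficit (d : measure_display) (T : measurableType d)
    (R : realType) (m : {finite_measure set T -> \bar R})
    (mu : {measure set T -> \bar R}) (f g : T -> \bar R) (eps K : R)
    (S : set T) :
  (0 < eps)%R -> (0 < K)%R -> measurable S ->
  m.-integrable [set: T] g -> mu.-integrable [set: T] f ->
  (forall s, 0 <= g s) ->
  \int[mu]_(s in S) f s <=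
  \int[m]_(s in S) g s +
    (K%:E * tv_dist m mu +
     (eps%:E * mu [set: T] + K%:E * mu [set s | g s <= f s - eps%:E] +
      \int[mu]_s maxe (f s - K%:E) 0)).
Proof.
move=> eps0 K0 mS ig jf g0.
have mf := measurable_int _ jf; have mg := measurable_int _ ig.
set A := [set s | _]; have mA : measurable A by exact: measurable_deficit_set.
pose gK s := mine (g s) K%:E.
pose w s := eps%:E + K%:E * (\1_A s)%:E + maxe (f s - K%:E) 0.
have mgK : measurable_fun [set: T] gK by exact: measurable_mine.
have mt : measurable_fun [set: T] (fun s => maxe (f s - K%:E) 0).
  by apply: measurable_maxe => //; exact: emeasurable_funB.
have mK1 : measurable_fun [set: T] (fun s => K%:E * (\1_A s)%:E).
  by apply: emeasurable_funM => //; apply/measurable_EFinP.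
have mw : measurable_fun [set: T] w.
  by apply: emeasurable_funD => //; apply: emeasurable_funD.
have K1ge0 s : 0 <= K%:E * (\1_A s)%:E by rewrite mule_ge0// lee_fin// ltW.
have t0 s : 0 <= maxe (f s - K%:E) 0 by rewrite le_max lexx orbT.
have w0 s : 0 <= w s by rewrite !adde_ge0// lee_fin ltW.
have gK0 s : 0 <= gK s by rewrite le_min g0 lee_fin ltW.
(* Working with the positive part of f lets every integral below be one of
   nonnegative functions. *)
have fle s : maxe (f s) 0 <= gK s + w s.
  rewrite ge_max; apply/andP; split; last exact: adde_ge0.
  have fK : f s <= mine (f s) K%:E + maxe (f s - K%:E) 0.
    have [fK|Kf] := leP (f s) K%:E; first by rewrite leeDl.
    by rewrite addeC -leeBlDr// le_max lexx.
  apply: le_trans fK _; rewrite /w addeA; apply: leeD2r.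
  (* On A the term K of w bounds the truncation of f; off A, g > f - eps. *)
  have [sA|sA] := pselect (A s).
    rewrite indicE mem_set// mule1; apply: (@le_trans _ _ K%:E).
      by rewrite ge_min lexx orbT.
    by rewrite addeA leeDr// adde_ge0// lee_fin ltW.
  rewrite addeA; apply: (@le_trans _ _ (gK s + eps%:E)); last exact: leeDl.
  have /negP := sA; rewrite /A/= -ltNge => /ltW fg.
  rewrite -leeBlDr// le_min; apply/andP; split.
    by apply: le_trans fg; apply: leeD2r; rewrite ge_min lexx.
  by rewrite leeBlDr// ge_min leeDl ?orbT// lee_fin ltW.
have intw : \int[mu]_(s in S) w s <= eps%:E * mu [set: T] + K%:E * mu A +
    \int[mu]_s maxe (f s - K%:E) 0.
  apply: (@le_trans _ _ (\int[mu]_s w s)).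
    exact: ge0_subset_integral.
  rewrite ge0_integralD//; last 2 first.
    - by move=> s _; rewrite adde_ge0// lee_fin ltW.
    - exact: emeasurable_funD.
  rewrite ge0_integralD//; last by move=> s _; rewrite lee_fin ltW.
  rewrite integral_cst// ge0_integralZl_EFin//.
  - by rewrite integral_indic// setIT.
  - by apply/measurable_EFinP.
  - exact: ltW.
have tv : \int[mu]_(s in S) gK s <= \int[m]_(s in S) g s + K%:E * tv_dist m mu.
  have gS0K s : 0 <= (gK \_ S) s <= K%:E.
    rewrite patchE; case: ifPn => _; last first.
    by rewrite lexx lee_fin; exact: ltW.
    by rewrite gK0/= ge_min lexx orbT.
  have mgS : measurable_fun [set: T] (gK \_ S).
    exact: (measurable_restrictT gK mS).1 (measurable_funTS mgK).
  have := tv_dist_integral m mu K0 mgS gS0K.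
  rewrite -!integral_mkcond => tv.
  have gKg : \int[m]_(s in S) gK s <= \int[m]_(s in S) g s.
    apply: ge0_le_integral => //; try exact: measurable_funTS.
    by move=> s _; rewrite ge_min lexx.
  have fin : \int[m]_(s in S) gK s \is a fin_num.
    rewrite ge0_fin_numE; last exact: integral_ge0.
    apply: le_lt_trans gKg _; apply: integrable_lty => //; exact: integrableS ig.
  apply: (@le_trans _ _ (\int[m]_(s in S) gK s + K%:E * tv_dist m mu)); last first.
    exact: leeD2r.
  rewrite -leeBlDl//; apply: le_trans tv.
  case: (\int[m]_(s in S) gK s) fin => // x _.
  by case: (\int[mu]_(s in S) gK s) => //= y; rewrite lee_fin distrC ler_norm.
apply: (@le_trans _ _ (\int[mu]_(s in S) maxe (f s) 0)).
  rewrite [leLHS]integralE.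
  rewrite [leRHS](_ : _ = \int[mu]_(s in S) f^\+ s); last first.
    by apply: eq_integral => s _; rewrite funeposE.
  rewrite -[leRHS]adde0; apply: leeD => //.
  by rewrite oppe_le0; apply: integral_ge0 => s _; exact: funeneg_ge0.
apply: (@le_trans _ _ (\int[mu]_(s in S) gK s + \int[mu]_(s in S) w s)).
  rewrite -ge0_integralD//; try exact: measurable_funTS.
  apply: ge0_le_integral => //.
  - by move=> s _; rewrite le_max lexx orbT.
  - apply: measurable_funTS; exact: measurable_maxe.
  - apply: measurable_funTS; exact: emeasurable_funD.
rewrite [leRHS]addeA; exact: leeD.
Qed.

(** * Tails of an integrable function *)

(** Dominated convergence along [K = 1, 2, ...]: the excess of [f] over [K]
vanishes eventually wherever [f] is finite, and is dominated by [|f|]. *)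
Lemma integrable_tail (d : measure_display) (T : measurableType d)
    (R : realType) (mu : {measure set T -> \bar R}) (f : T -> \bar R)
    (e : R) :
  mu.-integrable [set: T] f -> (0 < e)%R ->
  exists2 K : R, (0 < K)%R & \int[mu]_s maxe (f s - K%:E) 0 <= e%:E.
Proof.
move=> jf e0; have mf := measurable_int _ jf.
pose t (n : nat) s := maxe (f s - n.+1%:R%:E) 0.
have t0 n s : 0 <= t n s by rewrite le_max lexx orbT.
have mt n : measurable_fun [set: T] (t n).
  by apply: measurable_maxe => //; exact: emeasurable_funB.
have [] := @dominated_convergence _ _ _ mu _ measurableT t (cst 0) (abse \o f) mt.
- exact: measurable_cst.
- apply: filterS (integrable_ae measurableT jf) => s /(_ I) ffin _.
  apply: cvg_near_cst; near=> n; rewrite /t -(fineK ffin) -EFinN -EFinD.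
  apply/max_idPr; rewrite lee_fin subr_le0.
  near: n; apply: filterS (nbhs_infty_ger (fine (f s))) => n /le_trans; apply.
  by rewrite ler_nat.
- exact: integrable_abse.
- apply: aeW => s n _; rewrite gee0_abs// ge_max abse_ge0 andbT.
  by apply: le_trans (lee_abs _); rewrite leeBlDr// leeDl// lee_fin.
move=> _ _; rewrite integral_cst// mul0e => /ge0_cvge0P.
move=> /(_ (fun n => integral_ge0 _ (fun s _ => t0 n s)) e e0)[N _ /(_ N (leqnn N)) tN].
by exists N.+1%:R.
Unshelve. all: by end_near. Qed.

(** Markov's inequality for [|f|]. *)
Lemma integrable_upper_level (d : measure_display) (T : measurableType d)
    (R : realType) (mu : {measure set T -> \bar R}) (f : T -> \bar R)
    (e : R) :
  mu.-integrable [set: T] f -> (0 < e)%R ->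
  exists2 K : R, (0 < K)%R & mu [set s | K%:E < f s] <= e%:E.
Proof.
move=> jf e0; have [mf foo] := integrableP _ _ _ jf.
have I0 : 0 <= \int[mu]_s `|f s| by exact: integral_ge0.
have Ifin : \int[mu]_s `|f s| \is a fin_num by rewrite ge0_fin_numE.
set I := fine (\int[mu]_s `|f s|); have I0' : (0 <= I)%R by rewrite fine_ge0.
(* Adding 1 keeps K positive when f is negligible. *)
pose K := ((I + 1) / e)%R; have K0 : (0 < K)%R by rewrite divr_gt0// ltr_wpDl.
exists K => //.
have mA : measurable ([set: T] `&` [set s | K%:E <= `|f s|]).
  by apply: emeasurable_fun_c_infty => //; exact: measurableT_comp.
have := @le_integral_comp_abse _ _ _ mu _ measurableT f K id
  (@measurable_id _ _ _) (fun _ => id) (fun _ _ _ _ => id) mf K0.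
rewrite /= -(fineK Ifin) -/I muleC -lee_pdivlMr// => muA.
apply: (@le_trans _ _ (mu ([set: T] `&` [set s | K%:E <= `|f s|]))).
  rewrite le_measure ?inE//.
    by rewrite -[X in measurable X]setTI; exact: emeasurable_fun_o_infty.
  by move=> s /= Kf; split => //; apply: le_trans (lee_abs _); exact: ltW.
apply: le_trans muA _; rewrite -EFinM lee_fin ler_pdivrMr// /K mulrC divfK ?gt_eqF//.
by rewrite lerDl.
Qed.

(** * Lower semicontinuity in measure *)

Section deficit_criterion.
Context (d : measure_display) (T : measurableType d) (R : realType).
Variables (mu_ : nat -> {finite_measure set T -> \bar R})
  (mu : {measure set T -> \bar R}) (f_ : nat -> T -> \bar R) (f : T -> \bar R).
Hypothesis mu_cvg : cvg_total_variation mu_ mu.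
Hypothesis f_int : forall n, (mu_ n).-integrable [set: T] (f_ n).
Hypothesis f_ge0 : forall n s, 0 <= f_ n s.
Hypothesis fint : mu.-integrable [set: T] f.

Let mf : measurable_fun [set: T] f := measurable_int _ fint.

Let mf_ n : measurable_fun [set: T] (f_ n) := measurable_int _ (f_int n).

Let muT : mu [set: T] < +oo := cvg_total_variation_finite mu_cvg.

Let mdeficit eps n : measurable [set s | f_ n s <= f s - eps%:E].
Proof. exact: measurable_deficit_set. Qed.

Lemma near_tv_dist_le (K e : R) : (0 < K)%R -> (0 < e)%R ->
  \forall n \near \oo, K%:E * tv_dist (mu_ n) mu <= e%:E.
Proof.
move=> K0 e0.
have /ge0_cvge0P : tv_dist (mu_ n) mu @[n --> \oo] --> 0 by [].
move=> /(_ (fun=> tv_dist_ge0 _ _) (e / K)%R (divr_gt0 e0 K0)).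
by apply: filterS => n; rewrite EFinM lee_pdivlMr// muleC.
Qed.

Lemma liminf_inf_ge0_cvg_measure :
  0 <= limn_einf (fun n =>
         ereal_inf [set \int[mu_ n]_(s in S) f_ n s - \int[mu]_(s in S) f s
                   | S in [set S : set T | measurable S]]) ->
  forall eps : R, (0 < eps)%R ->
    mu [set s | f_ n s <= f s - eps%:E] @[n --> \oo] --> 0.
Proof.
move=> lim0 eps eps0; apply/ge0_cvge0P => // e e0.
have [K K0 muK] := integrable_upper_level fint (divr_gt0 e0 (@ltr0Sn R 1)).
have c0 : (0 < eps * e / 4)%R by rewrite divr_gt0// mulr_gt0.
have lim : - (eps * e / 4)%:E < limn_einf (fun n =>
    ereal_inf [set \int[mu_ n]_(s in S) f_ n s - \int[mu]_(s in S) f s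
              | S in [set S : set T | measurable S]]).
  by apply: lt_le_trans lim0; rewrite lte_fin oppr_lt0.
near=> n.
have dn : K%:E * tv_dist (mu_ n) mu <= (eps * e / 4)%:E.
  by near: n; exact: near_tv_dist_le.
have infn : - (eps * e / 4)%:E <= ereal_inf
    [set \int[mu_ n]_(s in S) f_ n s - \int[mu]_(s in S) f s
    | S in [set S : set T | measurable S]].
  by near: n; exact: lt_limn_einf.
pose B := [set s | K%:E < f s].
have mB : measurable B.
  by rewrite -[B]setTI; exact: emeasurable_fun_o_infty.
(* The infimum is tested on the part of A where f is at most K; the rest of A
   lies in B, which has small measure by the choice of K. *)
pose A := [set s | f_ n s <= f s - eps%:E]; have mA : measurable A by exact: mdeficit.
have mAB : measurable (A `\` B) by exact: measurableD.
have infS : - (eps * e / 4)%:E <=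
    \int[mu_ n]_(s in A `\` B) f_ n s - \int[mu]_(s in A `\` B) f s.
  by apply: le_trans infn _; apply: ereal_inf_lbound; exists (A `\` B).
have := @deficit_mass_le _ _ _ (mu_ n) mu f (f_ n) eps K _ eps0 K0 mAB
  (f_int n) fint muT (f_ge0 n).
have AB s : (A `\` B) s -> f_ n s <= f s - eps%:E /\ f s <= K%:E.
  by move=> [As /negP]; rewrite -leNgt.
move=> /(_ AB) /le_trans /(_ dn) deficit.
have muAB : mu (A `\` B) <= (e / 2)%:E.
  have muABfin : mu (A `\` B) \is a fin_num.
    by rewrite ge0_fin_numE// (le_lt_trans _ muT)// le_measure ?inE.
  have : eps%:E * mu (A `\` B) - (eps * e / 4)%:E <= (eps * e / 4)%:E.
    by apply: le_trans deficit; exact: leeD2l.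
  rewrite -(fineK muABfin) -EFinM -EFinN -EFinD !lee_fin => h.
  rewrite -(ler_pM2l eps0); lra.
apply: (@le_trans _ _ (mu ((A `\` B) `|` B))).
  rewrite le_measure ?inE//; first exact: measurableU.
  by move=> s As; have [Bs|Bs] := pselect (B s); [right|left].
apply: le_trans (measureU2 _ _ _) _ => //.
rewrite [e in leRHS](splitr e) EFinD; exact: leeD.
Unshelve. all: by end_near. Qed.

Lemma cvg_measure_liminf_inf_ge0 :
  (forall eps : R, (0 < eps)%R ->
    mu [set s | f_ n s <= f s - eps%:E] @[n --> \oo] --> 0) ->
  0 <= limn_einf (fun n =>
         ereal_inf [set \int[mu_ n]_(s in S) f_ n s - \int[mu]_(s in S) f s
                   | S in [set S : set T | measurable S]]).
Proof.
move=> muA; apply: limn_einf_ge => e e0; rewrite add0e.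
have e40 : (0 < e / 4)%R by rewrite divr_gt0.
have [K K0 tail] := integrable_tail fint e40.
have muTfin : mu [set: T] \is a fin_num by rewrite ge0_fin_numE.
have M0 : (0 <= fine (mu [set: T]))%R by rewrite fine_ge0.
(* Adding 1 allows mu to be the null measure. *)
pose eps := (e / 4 / (fine (mu [set: T]) + 1))%R.
have eps0 : (0 < eps)%R by rewrite divr_gt0// ltr_wpDl.
have muT_eps : eps%:E * mu [set: T] <= (e / 4)%:E.
  rewrite -(fineK muTfin) -EFinM lee_fin /eps mulrAC ler_pdivrMr ?ltr_wpDl//.
  by rewrite ler_wpM2l ?(ltW e40)// lerDl.
near=> n.
have dn : K%:E * tv_dist (mu_ n) mu <= (e / 4)%:E.
  by near: n; exact: near_tv_dist_le.
have An : K%:E * mu [set s | f_ n s <= f s - eps%:E] <= (e / 4)%:E.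
  rewrite muleC -lee_pdivlMr//; near: n.
  have /ge0_cvge0P := muA _ eps0; apply => //; exact: divr_gt0.
apply: le_ereal_inf_tmp => _ [S mS <-].
have ffin : \int[mu]_(s in S) f s \is a fin_num.
  by apply: integrable_fin_num => //; exact: integrableS fint.
have f_fin : \int[mu_ n]_(s in S) f_ n s \is a fin_num.
  by apply: integrable_fin_num => //; exact: integrableS (f_int n).
have := @integral_le_deficit _ _ _ (mu_ n) mu f (f_ n) eps K S eps0 K0 mS
  (f_int n) fint (f_ge0 n).
have : K%:E * tv_dist (mu_ n) mu + (eps%:E * mu [set: T] +
    K%:E * mu [set s | f_ n s <= f s - eps%:E] +
    \int[mu]_s maxe (f s - K%:E) 0) <= e%:E.
  rewrite [e in leRHS](_ : e = e / 4 + (e / 4 + e / 4 + e / 4))%R; last by field.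
  by rewrite !EFinD; do ![apply: leeD => //].
move=> le_e; move=> /le_trans /(_ (leeD2l _ le_e)).
rewrite -(fineK ffin) -(fineK f_fin) -!EFinN -!EFinD !lee_fin; lra.
Unshelve. all: by end_near. Qed.

Lemma cvg_measure_ae_subsequence :
  (forall eps : R, (0 < eps)%R ->
    mu [set s | f_ n s <= f s - eps%:E] @[n --> \oo] --> 0) ->
  exists2 phi : nat -> nat, increasing_seq phi &
    {ae mu, forall s, f s <= limn_einf (fun k => f_ (phi k) s)}.
Proof.
move=> muA; pose e k : R := (1 / (2 ^ k.+1)%:R)%R.
have e0 k : (0 < e k)%R by rewrite divr_gt0// ltr0n expn_gt0.
have /choice[N muN] : forall k, exists N, forall n, (N <= n)%N ->
    mu [set s | f_ n s <= f s - (e k)%:E] <= (e k)%:E.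
  move=> k; have /ge0_cvge0P := muA _ (e0 k).
  by move=> /(_ (fun=> measure_ge0 _ _) _ (e0 k))[N _ NP]; exists N.
(* The successor makes phi strictly increasing, the maximum keeps it above N. *)
pose phi := fix phi k := if k is k'.+1 then maxn (N k) (phi k').+1 else N 0%N.
have Nphi k : (N k <= phi k)%N by case: k => //= k; rewrite leq_maxl.
exists phi.
  by apply/increasing_seqP => k /=; rewrite ltEnat /= leq_maxr.
pose F k := [set s | f_ (phi k) s <= f s - (e k)%:E].
have mF k : measurable (F k) by exact: mdeficit.
have limF0 : mu (lim_sup_set F) = 0.
  apply: lim_sup_set_cvg0 => //.
  apply: (@le_lt_trans _ _ 1%:E); last exact: ltry.
  apply: le_trans (epsilon_trick0 xpredT ler01).
  by apply: lee_nneseries => // k _; exact: muN.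
have mlim : measurable (lim_sup_set F).
  by apply: bigcap_measurable => // k _; exact: bigcup_measurable.
apply: (@negligibleS _ _ _ _ (lim_sup_set F)); last exact/negligibleP.
move=> s /= nlim; apply: contrapT => /existsNP[k /not_implyP[_ nk]].
(* From the index k on, s lies in no F j; also e j <= a for j large. *)
apply: nlim; apply: limn_einf_ge => a a0.
near=> j; have ja : (e j <= a)%R.
  apply: (@le_trans _ _ (1 / 2 ^+ j)%R).
    by rewrite /e natrX ler_pM2l// lef_pV2 ?posrE ?exprn_gt0// ler_weXn2l ?ler1n.
  apply: ltW; near: j; exact: (near_infty_natSinv_expn_lt (PosNum a0)).
have : ~ F j s.
  move=> Fj; apply: nk; exists j => //=.
  by near: j; exact: nbhs_infty_ge.
rewrite /F /= => /negP; rewrite -ltNge => /ltW; apply: le_trans.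
by apply: leeD2l; rewrite lee_fin lerN2.
Unshelve. all: by end_near. Qed.

End deficit_criterion.

Unset Implicit Arguments.

Theorem corollary1p3 (d : measure_display) (T : measurableType d)
    (R : realType)
    (mu_ : nat -> {finite_measure set T -> \bar R})
    (mu : {measure set T -> \bar R})
    (f_ : nat -> T -> \bar R) (f : T -> \bar R)
    (mu_cvg : cvg_total_variation mu_ mu)
    (f_int : forall n, (mu_ n).-integrable setT (f_ n))
    (f_ge0 : forall n s, 0 <= f_ n s)
    (fint : mu.-integrable setT f) :
  (0 <= limn_einf (fun n =>
          ereal_inf [set \int[mu_ n]_(s in S) f_ n s - \int[mu]_(s in S) f s
                    | S in [set S : set T | measurable S]])
   <->
   forall eps : R, (0 < eps)%R ->
     mu [set s | f_ n s <= f s - eps%:E] @[n --> \oo] --> 0)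
  /\
  ((forall eps : R, (0 < eps)%R ->
      mu [set s | f_ n s <= f s - eps%:E] @[n --> \oo] --> 0) ->
   exists2 phi : nat -> nat, increasing_seq phi &
     {ae mu, forall s, f s <= limn_einf (fun k => f_ (phi k) s)}).
Proof.
split; last exact: (cvg_measure_ae_subsequence f_int).
split.
- exact: liminf_inf_ge0_cvg_measure.
- exact: cvg_measure_liminf_inf_ge0.
Qed.
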